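(* For every matroid $\mathcal M=(E,\mathcal I)$ with $E\ne\emptyset$ and no loops, $$\frac{1}{\min_{e\in E}\ell^*(e)}=\max_{\emptyset\neq A\subseteq E}\frac{|A|}{\mathrm{rk}(A)}.$$
   Context: $\mathrm{rk}(A)=\max\{|A'|:A'\in\mathcal I,A'\subseteq A\}$. For a matroid $\mathcal N$ on ground set $F$, $\Phi_{\mathcal N}=\min\{|A|/(\mathrm{rk}(F)-\mathrm{rk}(F\setminus A)): A\subseteq F,\mathrm{rk}(F\setminus A)<\mathrm{rk}(F)\}$. The restriction $\mathcal M|A$ is the matroid on $A$ with independent sets $\{X\in\mathcal I: X\subseteq A\}$. Ideal relative loads $\ell^*$: choose $A_0\subseteq E$ attaining $\Phi_{\mathcal M}$, set $\ell^*(e)=1/\Phi_{\mathcal M}$ for all $e\in A_0$, and recurse on $\mathcal M|(E\setminus A_0)$ until every element is assigned (the result does not depend on the choices). *)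

(* Defs.v *)
From HB Require Import structures.
From mathcomp Require Import all_boot all_order all_algebra.

Set Implicit Arguments.
Unset Strict Implicit.
Unset Printing Implicit Defensive.

Import Order.TTheory GRing.Theory Num.Theory.
Local Open Scope ring_scope.

(* The ground set is a field of the structure rather than the carrier type, so
   that a restriction of a matroid is again a matroid over the same type. *)
Record matroid (T : finType) := Matroid {
  ground : {set T};
  indep : {set {set T}};
  indep_ground : forall X : {set T}, X \in indep -> X \subset ground;
  indep0 : set0 \in indep;
  indepS : forall X Y : {set T}, Y \in indep -> X \subset Y -> X \in indep;
  indep_augment : forall X Y : {set T}, X \in indep -> Y \in indep -> (#|X| < #|Y|)%N ->
    exists2 e, e \in Y :\: X & e |: X \in indep }.

Definition rk (T : finType) (M : matroid T) (A : {set T}) : nat :=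
  \max_(X in indep M | X \subset A) #|X|.

Definition loopless (T : finType) (M : matroid T) : Prop :=
  forall e, e \in ground M -> [set e] \in indep M.

Section Restriction.
Variables (T : finType) (M : matroid T) (A : {set T}).

Definition restrict_indep : {set {set T}} :=
  [set X in indep M | X \subset A].

Fact restrict_indep_ground (X : {set T}) : X \in restrict_indep -> X \subset A.
Proof. by rewrite inE => /andP[]. Qed.

Fact restrict_indep0 : set0 \in restrict_indep.
Proof. by rewrite inE indep0 sub0set. Qed.

Fact restrict_indepS (X Y : {set T}) :
  Y \in restrict_indep -> X \subset Y -> X \in restrict_indep.
Proof.
rewrite !inE => /andP[IY YA] XY.
by rewrite (indepS IY XY) (subset_trans XY YA).
Qed.

Fact restrict_indep_augment (X Y : {set T}) :
  X \in restrict_indep -> Y \in restrict_indep -> (#|X| < #|Y|)%N ->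
  exists2 e, e \in Y :\: X & e |: X \in restrict_indep.
Proof.
rewrite !inE => /andP[IX XA] /andP[IY YA] ltXY.
have [e eYX IeX] := indep_augment IX IY ltXY.
exists e => //; rewrite inE IeX subUset XA sub1set (subsetP YA) //.
by case/setDP: eYX.
Qed.

Definition restrict : matroid T :=
  Matroid restrict_indep_ground restrict_indep0 restrict_indepS
          restrict_indep_augment.

End Restriction.

(* Minimum and maximum of F over the elements satisfying P; the value 0 when no
   element satisfies P is a junk value. *)
Definition min_over (I : finType) (P : pred I) (F : I -> rat) : rat :=
  if [pick i | P i] is Some i0 then F [arg min_(i < i0 | P i) F i]%O else 0.

Definition max_over (I : finType) (P : pred I) (F : I -> rat) : rat :=
  if [pick i | P i] is Some i0 then F [arg max_(i > i0 | P i) F i]%O else 0.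

Lemma min_overP (I : finType) (P : pred I) (F : I -> rat) i0 : P i0 ->
  (exists2 i, P i & min_over P F = F i) /\
  (forall i, P i -> min_over P F <= F i).
Proof.
rewrite /min_over => Pi0; case: pickP => [i1 Pi1|/(_ i0)]; last by rewrite Pi0.
by case: arg_minP => // i Pi le_i; split; first exists i.
Qed.

Lemma max_overP (I : finType) (P : pred I) (F : I -> rat) i0 : P i0 ->
  (exists2 i, P i & max_over P F = F i) /\
  (forall i, P i -> F i <= max_over P F).
Proof.
rewrite /max_over => Pi0; case: pickP => [i1 Pi1|/(_ i0)]; last by rewrite Pi0.
by case: arg_maxP => // i Pi le_i; split; first exists i.
Qed.

Definition Phi_feasible (T : finType) (M : matroid T) : pred {set T} :=
  fun A => (A \subset ground M) &&
           (rk M (ground M :\: A) < rk M (ground M))%N.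

Definition Phi_ratio (T : finType) (M : matroid T) (A : {set T}) : rat :=
  #|A|%:R / ((rk M (ground M))%:R - (rk M (ground M :\: A))%:R).

Definition Phi (T : finType) (M : matroid T) : rat :=
  min_over (Phi_feasible M) (Phi_ratio M).

Definition attains_Phi (T : finType) (M : matroid T) (A : {set T}) : Prop :=
  Phi_feasible M A /\ Phi_ratio M A = Phi M.

(* [ideal_loads M l]: some run of the recursive procedure on M, with arbitrary
   choices of the sets A0, assigns the loads l on the ground set of M. The
   values of l outside the ground set are unconstrained. *)
Inductive ideal_loads (T : finType) (M : matroid T) (l : T -> rat) : Prop :=
| IdealLoadsDone of ground M = set0
| IdealLoadsStep (A0 : {set T}) of
    attains_Phi M A0 &
    (forall e, e \in A0 -> l e = 1 / Phi M) &
    ideal_loads (restrict M (ground M :\: A0)) l.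

Lemma eq_ideal_loads (T : finType) (M : matroid T) (l l' : T -> rat) :
  {in ground M, l =1 l'} -> ideal_loads M l -> ideal_loads M l'.
Proof.
move=> + run; elim: run => {}M {}l; first by move=> M0 _; apply: IdealLoadsDone.
move=> A0 attA0 lA0 _ IH ll'; apply: (IdealLoadsStep attA0).
  move=> e eA0; rewrite -ll' ?lA0 //.
  by case: attA0 => /andP[/subsetP /(_ _ eA0)].
by apply: IH => e /setDP[eM _]; apply: ll'.
Qed.

Lemma ideal_loads_exist (T : finType) (M : matroid T) :
  loopless M -> exists l, ideal_loads M l.
Proof.
have [n] := ubnP #|ground M|; elim: n M => // n IHn M ltMn loopM.
have [M0|[e eM]] := set_0Vmem (ground M).
  by exists (fun=> 0); apply: IdealLoadsDone.
have feasM : Phi_feasible M (ground M).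
  rewrite /Phi_feasible subxx setDv.
  have -> : rk M set0 = 0%N.
    apply/eqP; rewrite -leqn0; apply/bigmax_leqP => X /andP[_].
    by rewrite subset0 => /eqP->; rewrite cards0.
  rewrite -(cards1 e); apply: (@leq_bigmax_cond _ _ (fun X : {set T} => #|X|)).
  by rewrite loopM ?sub1set.
have [[A0 feasA0 PhiA0] _] := min_overP (Phi_ratio M) feasM.
have A0_proper : (#|ground M :\: A0| < #|ground M|)%N.
  apply: proper_card; rewrite properEneq subsetDl andbT.
  by apply: contraTneq feasA0 => eqM; rewrite /Phi_feasible eqM ltnn andbF.
have [||l run] := IHn (restrict M (ground M :\: A0)).
- exact: leq_trans A0_proper _.
- move=> x /[dup] xR /setDP[xM _].
  by rewrite inE loopM // sub1set.
exists (fun x => if x \in A0 then 1 / Phi M else l x).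
apply: (@IdealLoadsStep _ _ _ A0); first by split.
  by move=> x ->.
by apply: eq_ideal_loads run => x /setDP[_ /negPf->].
Qed.

(* Main.v *)
Require Import Defs.
From HB Require Import structures.
From mathcomp Require Import all_boot all_order all_algebra.
From mathcomp Require Import lra.

Set Implicit Arguments.
Unset Strict Implicit.
Unset Printing Implicit Defensive.

Import Order.TTheory GRing.Theory Num.Theory.
Local Open Scope ring_scope.

(** Let mu be the maximal density |A| / rk A. Each step of the recursion has
    Phi <= |E'| / rk E' <= mu, where E' is the current ground set, so every load
    is at least 1 / mu. Conversely, follow a set X with |X| >= mu rk X through
    the recursion. If a step removes A0 with Phi < mu, then comparing A0 with
    A0 \ X and using submodularity of the rank gives
    |X :&: A0| <= Phi (rk X - rk (X \ A0)), so X \ A0 is still nonempty and at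
    least as dense as mu. Hence some step must have Phi >= mu, and the elements
    it removes have load at most 1 / mu. *)

Section Rank.
Variables (T : finType) (M : matroid T).
Implicit Types A B I S : {set T}.

Lemma card_indep_le_rk I A : I \in indep M -> I \subset A -> (#|I| <= rk M A)%N.
Proof.
move=> II IA.
by apply: (@leq_bigmax_cond _ _ (fun X : {set T} => #|X|)); rewrite II.
Qed.

Lemma rk_mono A B : A \subset B -> (rk M A <= rk M B)%N.
Proof.
move=> AB; apply/bigmax_leqP => X /andP[IX XA].
exact: card_indep_le_rk IX (subset_trans XA AB).
Qed.

Lemma rk0 : rk M set0 = 0%N.
Proof.
apply/eqP; rewrite -leqn0; apply/bigmax_leqP => X /andP[_].
by rewrite subset0 => /eqP->; rewrite cards0.
Qed.

Lemma rk_basis A : exists2 I, I \in indep M & I \subset A /\ #|I| = rk M A.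
Proof.
pose P (I : {set T}) := (I \in indep M) && (I \subset A).
have P0 : P set0 by rewrite /P indep0 sub0set.
case: (arg_maxnP (fun I : {set T} => #|I|) P0) => I /andP[II IA] maxI.
exists I => //; split=> //; apply/eqP; rewrite eqn_leq card_indep_le_rk //=.
by apply/bigmax_leqP.
Qed.

(** A largest independent set between [I] and [A] is a basis of [A]: otherwise augmenting it from a
    basis of [A] gives a larger set in the same range. *)
Lemma indep_extend_basis I A : I \in indep M -> I \subset A ->
  exists2 J, J \in indep M & [/\ I \subset J, J \subset A & #|J| = rk M A].
Proof.
move=> II IA.
pose P J := [&& J \in indep M, I \subset J & J \subset A].
have PI : P I by rewrite /P II subxx.
case: (arg_maxnP (fun J : {set T} => #|J|) PI) => J /and3P[IJ subIJ JA] maxJ.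
exists J => //; split=> //; apply/eqP; rewrite eqn_leq card_indep_le_rk //=.
have [B IB [BA <-]] := rk_basis A.
rewrite leqNgt; apply/negP => /(indep_augment IJ IB)[e /setDP[eB eJ] IeJ].
have /maxJ : P (e |: J).
  by rewrite /P IeJ (subset_trans subIJ (subsetUr _ _)) subUset sub1set
             (subsetP BA).
by rewrite /= cardsU1 eJ ltnn.
Qed.

(** Extend a basis [I] of [A :&: B] to a basis [J] of [A :|: B]. The traces of [J] on [A] and [B]
    are independent, and their sizes add up to [#|J| + #|J :&: (A :&: B)|], where the last set
    contains [I]. *)
Lemma rk_submod A B :
  (rk M (A :|: B) + rk M (A :&: B) <= rk M A + rk M B)%N.
Proof.
have [I II [IAB <-]] := rk_basis (A :&: B).
have IU : I \subset A :|: B.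
  exact: subset_trans IAB (subset_trans (subsetIl _ _) (subsetUl _ _)).
have [J IJ [subIJ JU <-]] := indep_extend_basis II IU.
have leA : (#|J :&: A| <= rk M A)%N.
  by rewrite card_indep_le_rk ?subsetIr // (indepS IJ) ?subsetIl.
have leB : (#|J :&: B| <= rk M B)%N.
  by rewrite card_indep_le_rk ?subsetIr // (indepS IJ) ?subsetIl.
apply: leq_trans (leq_add leA leB).
rewrite -[leqRHS]cardsUI -setIUr -setIIr (setIidPl JU) leq_add2l subset_leq_card //.
by rewrite subsetI subIJ.
Qed.

Lemma rk_restrict S A : A \subset S -> rk (restrict M S) A = rk M A.
Proof.
move=> AS; apply: eq_bigl => X; rewrite inE -andbA.
by case: (boolP (X \subset A)) => [/subset_trans->|]; rewrite ?andbF.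
Qed.

Lemma loopless_restrict S :
  loopless M -> S \subset ground M -> loopless (restrict M S).
Proof.
by move=> loopM SM e eS; rewrite inE loopM ?sub1set ?(subsetP SM).
Qed.

Lemma rk_gt0 A : loopless M -> A \subset ground M -> A != set0 ->
  (0 < rk M A)%N.
Proof.
move=> loopM AM /set0Pn[e eA]; rewrite -(cards1 e) card_indep_le_rk ?sub1set //.
by rewrite loopM ?(subsetP AM).
Qed.

End Rank.

Section Phi.
Variables (T : finType) (M : matroid T).
Implicit Types A X : {set T}.

Lemma Phi_ratio_denom_gt0 A : Phi_feasible M A ->
  0 < (rk M (ground M))%:R - (rk M (ground M :\: A))%:R :> rat.
Proof. by case/andP=> _ ltA; rewrite subr_gt0 ltr_nat. Qed.

Lemma Phi_feasible_neq0 A : Phi_feasible M A -> A != set0.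
Proof.
by apply: contraTneq => ->; rewrite /Phi_feasible setD0 ltnn andbF.
Qed.

Lemma attains_Phi_gt0 A : attains_Phi M A -> 0 < Phi M.
Proof.
case=> feasA <-; apply: divr_gt0; last exact: Phi_ratio_denom_gt0.
by rewrite ltr0n card_gt0 Phi_feasible_neq0.
Qed.

(** Clearing the denominator extends the minimality of [Phi M] to infeasible sets, whose rank drop
    is zero. *)
Lemma Phi_lower_bound A : A \subset ground M ->
  Phi M * ((rk M (ground M))%:R - (rk M (ground M :\: A))%:R) <= #|A|%:R.
Proof.
move=> AM; have [feasA|] := boolP (Phi_feasible M A).
  rewrite -ler_pdivlMr ?Phi_ratio_denom_gt0 //.
  by have [_ ->] := min_overP (Phi_ratio M) feasA.
rewrite /Phi_feasible AM /= -leqNgt => leA.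
have -> : rk M (ground M) = rk M (ground M :\: A).
  by apply/eqP; rewrite eqn_leq leA rk_mono ?subsetDl.
by rewrite subrr mulr0.
Qed.

Lemma attains_Phi_card A : attains_Phi M A ->
  #|A|%:R = Phi M * ((rk M (ground M))%:R - (rk M (ground M :\: A))%:R).
Proof.
by case=> feasA <-; rewrite divfK // gt_eqF ?Phi_ratio_denom_gt0.
Qed.

(** Subtract the lower bound for [A :\: X] from the equality for [A]: [#|X :&: A|] is at most
    [Phi M] times the difference of the two rank drops. Submodularity for [ground M :\: A] and [X]
    bounds this difference by the drop from [X] to [X :\: A]. *)
Lemma card_setI_attains_Phi A X : attains_Phi M A -> X \subset ground M ->
  #|X :&: A|%:R <= Phi M * ((rk M X)%:R - (rk M (X :\: A))%:R).
Proof.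
move=> attA XM; have Phi_gt0 := attains_Phi_gt0 attA.
have AM : A \subset ground M by case: attA => /andP[].
have lbA := Phi_lower_bound (subset_trans (subsetDl A X) AM).
have cardA := attains_Phi_card attA.
have : #|A|%:R = #|X :&: A|%:R + #|A :\: X|%:R :> rat.
  by rewrite -natrD setIC cardsID.
have := rk_submod M (ground M :\: A) X.
have -> : (ground M :\: A) :|: X = ground M :\: (A :\: X).
  by rewrite setDDr (setIidPr XM).
have -> : (ground M :\: A) :&: X = X :\: A.
  by rewrite setIDAC (setIidPr XM).
rewrite -(ler_nat rat) !natrD -(ler_pM2l Phi_gt0) !mulrDr.
move: lbA cardA; rewrite !mulrBr; lra.
Qed.

End Phi.

Section IdealLoads.
Variable T : finType.

(** The density bound quantifies over all subsets of the ground set, so it passes to restrictions,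
    which keep the ranks of their subsets. *)
Lemma ideal_loads_ge (M : matroid T) (l : T -> rat) (mu : rat) :
  loopless M -> ideal_loads M l ->
  (forall A : {set T}, A \subset ground M -> #|A|%:R <= mu * (rk M A)%:R) ->
  forall e, e \in ground M -> 1 / mu <= l e.
Proof.
move=> + run; elim: run => {M l} [M l M0 _ _ e|M l A attA lA _ IH loopM mu_bound e eM].
  by rewrite M0 inE.
have [eA|eA] := boolP (e \in A); last first.
  apply: IH; last by rewrite inE eA.
    by apply: loopless_restrict; rewrite ?subsetDl.
  move=> B /[dup] BD /subset_trans/(_ (subsetDl _ _)) BM.
  by rewrite rk_restrict ?mu_bound.
have rkM : 0 < (rk M (ground M))%:R :> rat.
  by rewrite ltr0n rk_gt0 //; apply/set0Pn; exists e.
have Phi_gt0 := attains_Phi_gt0 attA.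
have le_Phi_mu : Phi M <= mu.
  (* Test [Phi M] on the whole ground set, whose removal drops the rank to 0. *)
  have := Phi_lower_bound (subxx (ground M)).
  rewrite setDv rk0 subr0 => /le_trans/(_ (mu_bound _ (subxx _))).
  by rewrite ler_pM2r.
by rewrite lA // !div1r lef_pV2 ?posrE ?(lt_le_trans Phi_gt0).
Qed.

(** Here [mu] is any positive lower bound on the density of [X]; it stays fixed while [X] shrinks
    along the run. *)
Lemma ideal_loads_le (M : matroid T) (l : T -> rat) (mu : rat) (X : {set T}) :
  0 < mu -> loopless M -> ideal_loads M l ->
  X != set0 -> X \subset ground M -> mu * (rk M X)%:R <= #|X|%:R ->
  exists2 e, e \in ground M & l e <= 1 / mu.
Proof.
move=> mu_gt0 + run; elim: run X => {M l} [M l M0|M l A attA lA _ IH] X loopM X0 XM muX.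
  by rewrite M0 subset0 (negPf X0) in XM.
have [feasA _] := attA.
have AM : A \subset ground M by case/andP: feasA.
have Phi_gt0 := attains_Phi_gt0 attA.
have [le_mu_Phi|lt_Phi_mu] := leP mu (Phi M).
  have /set0Pn[e eA] := Phi_feasible_neq0 feasA.
  by exists e; rewrite ?(subsetP AM) // lA // !div1r lef_pV2 ?posrE.
have cardX : #|X|%:R = #|X :&: A|%:R + #|X :\: A|%:R :> rat.
  by rewrite -natrD cardsID.
have cardXA := card_setI_attains_Phi attA XM.
have rkX : 0 < (rk M X)%:R :> rat by rewrite ltr0n rk_gt0.
have rkXA : (rk M (X :\: A))%:R <= (rk M X)%:R :> rat.
  by rewrite ler_nat rk_mono ?subsetDl.
have XDM : X :\: A \subset ground M :\: A by rewrite setSD.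
have [||||e /setDP[eM _] le_e] := IH (X :\: A); last by exists e.
- by apply: loopless_restrict; rewrite ?subsetDl.
(* If [X] were contained in [A], then [#|X|] would be at most [Phi M * rk M X], hence less than
   [mu * rk M X]. *)
- apply/eqP => XA0; move: cardXA cardX; rewrite XA0 rk0 cards0 subr0 addr0.
  have : Phi M * (rk M X)%:R < mu * (rk M X)%:R by rewrite ltr_pM2r.
  lra.
- exact: XDM.
rewrite rk_restrict //.
(* So [X] loses at most [mu] elements per unit of rank lost, which preserves density at least
   [mu]. *)
have : Phi M * ((rk M X)%:R - (rk M (X :\: A))%:R)
    <= mu * ((rk M X)%:R - (rk M (X :\: A))%:R).
  by rewrite ler_wpM2r ?subr_ge0 // ltW.
move: muX; rewrite (mulrBr mu); lra.
Qed.

End IdealLoads.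

Theorem theorem1p8 (T : finType) (M : matroid T) (l : T -> rat)
    (groundM : ground M != set0) (loopM : loopless M) (lM : ideal_loads M l) :
  1 / min_over (fun e => e \in ground M) l =
  max_over (fun A : {set T} => (A != set0) && (A \subset ground M))
           (fun A => #|A|%:R / (rk M A)%:R).
Proof.
have [e0 e0M] := set0Pn _ groundM.
have [[e eM ->] le_min] := min_overP (P := fun e => e \in ground M) l e0M.
pose P (A : {set T}) := (A != set0) && (A \subset ground M).
pose F (A : {set T}) : rat := #|A|%:R / (rk M A)%:R.
have PM : P (ground M) by rewrite /P groundM subxx.
have rk_pos A : P A -> 0 < (rk M A)%:R :> rat.
  by case/andP=> A0 AM; rewrite ltr0n rk_gt0.
have [[X PX maxX] ge_max] := max_overP F PM.
rewrite -[RHS]/(max_over P F); set mu := max_over P F in maxX ge_max *.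
have /andP[X0 XM] := PX.
have mu_gt0 : 0 < mu by rewrite maxX divr_gt0 ?rk_pos // ltr0n card_gt0.
have le_mu : 1 / mu <= l e.
  apply: (ideal_loads_ge loopM lM) => // A AM.
  (* The maximum ranges over nonempty sets only; for the empty set both sides are 0. *)
  have [->|A0] := eqVneq A set0; first by rewrite cards0 rk0 mulr0.
  have PA : P A by rewrite /P A0.
  by rewrite -ler_pdivrMr ?rk_pos // ge_max.
have muX : mu * (rk M X)%:R <= #|X|%:R.
  by rewrite maxX divfK // gt_eqF ?rk_pos.
have [e1 e1M le_e1] := ideal_loads_le mu_gt0 loopM lM X0 XM muX.
(* The minimizer [e] has load at most that of [e1]. *)
have -> : l e = 1 / mu.
  by apply/le_anti; rewrite le_mu (le_trans (le_min _ e1M)).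
by rewrite !div1r invrK.
Qed.
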